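(* The compact problem (CH-MIESDP), obtained by minimizing $\mathrm{tr}(Q_0X)+c_0^Tx$ subject to the common constraints and the compact system $$\tilde y=\sum_{k\in D_i}\tilde u_{ik}\ (i\in S_I),\qquad \lambda_{ik}\underline{\tilde y}\le\tilde u_{ik}\le\lambda_{ik}\overline{\tilde y}\ (k\in D_i,\ i\in S_I),$$ $$\tilde A_{ik}\tilde u_{ik}=\lambda_{ik}\tilde B_{ik}\ (k\in D_i,\ i\in S_I),\qquad \sum_{k\in D_i}\lambda_{ik}=1\ (i\in S_I),\qquad \lambda_{ik}\in\{0,1\},$$ is equivalent to the problem of minimizing $\mathrm{tr}(Q_0X)+c_0^Tx$ subject to the common constraints and the full system $$y=\sum_{k\in D_i}u_{ik}\ (i\in S_I),\qquad \lambda_{ik}\underline{y}\le u_{ik}\le\lambda_{ik}\overline{y}\ (k\in D_i,\ i\in S_I),$$ $$A_{ik}u_{ik}=\lambda_{ik}B_{ik}\ (k\in D_i,\ i\in S_I),\qquad \sum_{k\in D_i}\lambda_{ik}=1\ (i\in S_I),\qquad \lambda_{ik}\in\{0,1\}.$$ That is, the feasible sets of the two problems have the same projection onto the $(x,X)$-space (the objective, which depends only on $(x,X)$, being the same).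
   Context: Variables: $x\in\mathbb{R}^n$, a real symmetric $n\times n$ matrix $X$, scalars $\lambda_{ik}$, and auxiliary vectors $u_{ik}$ (full system) or $\tilde u_{ik}$ (compact system), for $i\in S_I$, $k\in D_i$. $S_I\subseteq\{1,\dots,n\}$ indexes the integer variables. For $i\in S_I$, $D_i$ is a finite index set and $\{a_{ik}:k\in D_i\}$ is the finite set of admissible (distinct, integer) values of $x_i$. Common constraints on $(x,X)$: $$\mathrm{tr}(Q_iX)+c_i^Tx\le b_i\ (i\in S_{QI}),\qquad \mathrm{tr}(Q_iX)+c_i^Tx=b_i\ (i\in S_{QE}),\qquad c_i^Tx\le b_i\ (i\in S_{LI}),$$ $$(\max\{0,\underline{x}_i\})^2\le X_{ii}\le\max\{\underline{x}_i^2,\overline{x}_i^2\}\ (i=1,\dots,n),\qquad \begin{bmatrix}1 & x^T \\ x & X\end{bmatrix}\succeq0,$$ $$c_i^TXc_j-(b_ic_j^T+b_jc_i^T)x+b_ib_j=0\ (i,j\in S_{LE}).$$ Here $S_{QI},S_{QE},S_{LI},S_{LE}$ are finite index sets, the $Q_i$ are real symmetric $n\times n$ matrices, $c_i\in\mathbb{R}^n$, $b_i\in\mathbb{R}$, and $\underline{x}_i\le\overline{x}_i$ are given bounds on $x_i$. Full system: $y=[X_{11},X_{12},\dots,X_{n,n-1},X_{nn},x_1,\dots,x_n]'$ collects all entries of $X$ and $x$; $\underline{y},\overline{y}$ are finite componentwise lower and upper bounds of $y$, valid for every $(x,X)$ satisfying the common constraints; $u_{ik}$ has the same dimension as $y$.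 The equation $A_{ik}y=B_{ik}$ is the matrix form of the linear equalities $x_i=a_{ik}$ and $X_{ij}-a_{ik}x_j=0$ ($j=1,\dots,n$). Compact system: $\tilde y$ is the subvector of $y$ consisting of the entries $X_{i1},\dots,X_{in}$ for all $i\in S_I$ and $x_1,\dots,x_n$ (the variables that appear in the linear equalities $x_i=a_{ik}$ and $X_{ij}-a_{ik}x_j=0$ ($j=1,\dots,n$) for some $i\in S_I$); $\underline{\tilde y},\overline{\tilde y}$ are the corresponding subvectors of $\underline{y},\overline{y}$; $\tilde u_{ik}$ has the same dimension as $\tilde y$. The equation $\tilde A_{ik}\tilde y=\tilde B_{ik}$ is the matrix form of the same linear equalities $x_i=a_{ik}$, $X_{ij}-a_{ik}x_j=0$ ($j=1,\dots,n$), i.e. $\tilde A_{ik},\tilde B_{ik}$ are obtained from $A_{ik},B_{ik}$ by deleting the zero columns for the variables not in $\tilde y$ and any zero rows. *)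

(* Defs.v *)
From HB Require Import structures.
From mathcomp Require Import all_boot all_order all_algebra.
From mathcomp Require Import reals.

Set Implicit Arguments.
Unset Strict Implicit.
Unset Printing Implicit Defensive.

Import Order.TTheory GRing.Theory Num.Theory.
Local Open Scope ring_scope.

Definition psdmx (R : realType) (m : nat) (M : 'M[R]_m) : Prop :=
  M^T = M /\ forall v : 'cV[R]_m, 0 <= (v^T *m M *m v) 0 0.

Record min_problem (R : realType) := MinProblem {
  var : Type;
  feasible : var -> Prop;
  objective : var -> R }.

(* Equivalence of two minimization problems relative to maps of their variables
   to a common space S: the feasible sets have the same image in S, and the
   objectives agree at points with the same image. *)
Definition equivalent_on (R : realType) (S : Type) (P1 P2 : min_problem R)
    (pi1 : var P1 -> S) (pi2 : var P2 -> S) : Prop :=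
  (forall s : S,
     (exists2 v, feasible v & pi1 v = s) <-> (exists2 v, feasible v & pi2 v = s))
  /\ (forall v1 v2, pi1 v1 = pi2 v2 -> objective v1 = objective v2).

(* The families Qmat, cvec, brhs share one index type, of which the index sets
   of the constraints are subsets.  Dom and aval are total in i; only their
   values at i \in S_I are ever used. *)
Record data (R : realType) (n : nat) := Data {
  idx : finType;
  Qmat : idx -> 'M[R]_n;
  cvec : idx -> 'cV[R]_n;
  brhs : idx -> R;
  S_QI : {set idx};
  S_QE : {set idx};
  S_LI : {set idx};
  S_LE : {set idx};
  Q0mat : 'M[R]_n;
  c0vec : 'cV[R]_n;
  xlo : 'cV[R]_n;
  xup : 'cV[R]_n;
  S_I : {set 'I_n};
  Dom : 'I_n -> finType;
  aval : forall i : 'I_n, Dom i -> int;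
  ylo : 'cV[R]_(n * n + n);
  yup : 'cV[R]_(n * n + n) }.

Section Problems.
Variables (R : realType) (n : nat) (P : data R n).

Definition obj (x : 'cV[R]_n) (X : 'M[R]_n) : R :=
  \tr (Q0mat P *m X) + ((c0vec P)^T *m x) 0 0.

Definition common_constraints (x : 'cV[R]_n) (X : 'M[R]_n) : Prop :=
  X^T = X /\
  [/\ forall i, i \in S_QI P -> \tr (Qmat i *m X) + ((cvec i)^T *m x) 0 0 <= brhs i,
      forall i, i \in S_QE P -> \tr (Qmat i *m X) + ((cvec i)^T *m x) 0 0 = brhs i
    & forall i, i \in S_LI P -> ((cvec i)^T *m x) 0 0 <= brhs i] /\
  [/\ forall i : 'I_n,
        Num.max 0 (xlo P i 0) ^+ 2 <= X i i
          <= Num.max (xlo P i 0 ^+ 2) (xup P i 0 ^+ 2),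
      psdmx (block_mx 1%:M x^T x X : 'M[R]_(1 + n))
    & forall i j, i \in S_LE P -> j \in S_LE P ->
        ((cvec i)^T *m X *m cvec j) 0 0
          - ((brhs i *: (cvec j)^T + brhs j *: (cvec i)^T) *m x) 0 0
          + brhs i * brhs j = 0].

Record point (N : nat) := Point {
  px : 'cV[R]_n;
  pX : 'M[R]_n;
  plam : forall i, Dom P i -> R;
  pu : forall i, Dom P i -> 'cV[R]_N }.

(* The disjunctive system over a vector y of any length N. *)
Definition hull_system (N : nat) (m : forall i, Dom P i -> nat)
    (A : forall i (k : Dom P i), 'M[R]_(m i k, N))
    (B : forall i (k : Dom P i), 'cV[R]_(m i k))
    (lo up y : 'cV[R]_N)
    (lam : forall i, Dom P i -> R) (u : forall i, Dom P i -> 'cV[R]_N) : Prop :=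
  forall i, i \in S_I P ->
  [/\ y = \sum_(k : Dom P i) u i k,
      forall (k : Dom P i) (r : 'I_N),
        lam i k * lo r 0 <= u i k r 0 <= lam i k * up r 0,
      forall k : Dom P i, A i k *m u i k = lam i k *: B i k,
      \sum_(k : Dom P i) lam i k = 1
    & forall k : Dom P i, lam i k = 0 \/ lam i k = 1].

(* y lists the n * n entries of X row by row, followed by those of x: X i j has
   index lshift n (mxvec_index i j) and x j has index rshift (n * n) j. *)
Definition yvec (x : 'cV[R]_n) (X : 'M[R]_n) : 'cV[R]_(n * n + n) :=
  col_mx (mxvec X)^T x.

(* The first row encodes x_i = a_ik, row 1 + j encodes X_ij - a_ik x_j = 0. *)
Definition Amx (i : 'I_n) (k : Dom P i) : 'M[R]_(1 + n, n * n + n) :=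
  block_mx 0                                 (delta_mx 0 i)
           (\matrix_j mxvec (delta_mx i j)) (- ((aval k)%:~R)%:M).

Definition Bmx (i : 'I_n) (k : Dom P i) : 'cV[R]_(1 + n) :=
  col_mx ((aval k)%:~R)%:M 0.

Lemma Amx_yvecP (i : 'I_n) (k : Dom P i) (x : 'cV[R]_n) (X : 'M[R]_n) :
  Amx k *m yvec x X = Bmx k <->
  x i 0 = (aval k)%:~R /\ forall j, X i j - (aval k)%:~R * x j 0 = 0.
Proof.
have E1 : delta_mx 0 i *m x = (x i 0)%:M :> 'M_1.
  by rewrite -rowE; apply/matrixP => p q; rewrite !ord1 !mxE.
have E2 j : ((\matrix_j mxvec (delta_mx i j)) *m (mxvec X)^T) j 0 = X i j.
  rewrite mxE (bigD1 (mxvec_index i j)) //= big1 ?addr0 => [|q].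
    by rewrite !mxE mxvecE mxvecE !mxE !eqxx mul1r.
  case/mxvec_indexP: q => i' j' ne; rewrite !mxE !mxvecE mxE.
  have [ei | _] := eqVneq i' i; last by rewrite mul0r.
  have [ej | _] := eqVneq j' j; last by rewrite mul0r.
  by rewrite ei ej eqxx in ne.
rewrite /Amx /yvec /Bmx mul_block_col mul0mx add0r E1; split=> [/eq_col_mx[e1 e2]|[e1 e2]].
  split; first by move/matrixP/(_ 0 0): e1; rewrite !mxE.
  move=> j; move/matrixP/(_ j 0): e2.
  by rewrite mxE E2 mulNmx mul_scalar_mx !mxE.
rewrite e1; congr col_mx; apply/matrixP => j p; rewrite ord1.
by rewrite mxE E2 mulNmx mul_scalar_mx !mxE.
Qed.

Definition full_problem : min_problem R :=
  @MinProblem R (point (n * n + n))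
    (fun p => common_constraints (px p) (pX p) /\
       hull_system Amx Bmx (ylo P) (yup P) (yvec (px p) (pX p))
         (@plam _ p) (@pu _ p))
    (fun p => obj (px p) (pX p)).

(* Indices in y of the entries X_ij with i \in S_I, and of all the x_j. *)
Definition ctcols : {set 'I_(n * n + n)} :=
  [set lshift n (mxvec_index i j) | i in S_I P, j in 'I_n]
  :|: [set rshift (n * n) j | j in 'I_n].

Lemma Amx_col0 (i : 'I_n) (k : Dom P i) (r : 'I_(n * n + n)) :
  i \in S_I P -> r \notin ctcols -> col r (Amx k) = 0.
Proof.
move=> iS; rewrite inE negb_or => /andP[nX nx].
apply/matrixP=> p q; rewrite [LHS]mxE [RHS]mxE; move: nX nx.
rewrite -[r]splitK; case: (split r) => /= s.
  case/mxvec_indexP: s => i' j' nX _.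
  rewrite -[p]splitK; case: (split p) => t /=; first by rewrite block_mxEul mxE.
  rewrite block_mxEdl mxE mxvecE mxE.
  case: eqP => //= ei; case: eqP => //= ej.
  by case/imset2P: nX; exists i' j'; rewrite ?inE // ei.
by move=> _ /imsetP[]; exists s.
Qed.

Definition subvec (N : nat) (J : {set 'I_N}) (v : 'cV[R]_N) : 'cV[R]_#|J| :=
  rowsub (fun r : 'I_#|J| => enum_val r) v.

Definition nzrows (i : 'I_n) (k : Dom P i) : {set 'I_(1 + n)} :=
  [set r | row r (Amx k) != 0].

Definition Atmx (i : 'I_n) (k : Dom P i) : 'M[R]_(#|nzrows k|, #|ctcols|) :=
  mxsub (fun r : 'I_#|nzrows k| => enum_val r)
        (fun s : 'I_#|ctcols| => enum_val s) (Amx k).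

Definition Btmx (i : 'I_n) (k : Dom P i) : 'cV[R]_#|nzrows k| :=
  subvec (nzrows k) (Bmx k).

Definition compact_problem : min_problem R :=
  @MinProblem R (point #|ctcols|)
    (fun p => common_constraints (px p) (pX p) /\
       hull_system Atmx Btmx (subvec ctcols (ylo P)) (subvec ctcols (yup P))
         (subvec ctcols (yvec (px p) (pX p))) (@plam _ p) (@pu _ p))
    (fun p => obj (px p) (pX p)).

End Problems.

(* Main.v *)
Require Import Defs.
From mathcomp Require Import all_boot all_order all_algebra.
From mathcomp Require Import reals.

Import Order.TTheory GRing.Theory Num.Theory.
Local Open Scope ring_scope.

(** The common constraints are the same in both problems, so only the
disjunctive systems attached to a fixed feasible pair [(x, X)] have to be
compared, with the same [lam].

From full to compact, restrict every [u i k] to the coordinates in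
[ctcols P].  All conditions but the linear one are coordinatewise, hence
survive; the linear one survives because the deleted columns of [Amx k] are
zero ([Amx_col0]), so that deleting rows and columns commutes with the product
([mulmx_mxsub_subvec]).

From compact to full, a vector [u i k] of the compact system must be given
values at the coordinates outside [ctcols P].  The linear equations do not see
these coordinates, and [lam i k * y r] is a valid value at [r]: these numbers
sum to [y r] over [k] because the [lam i k] sum to [1], and they lie between
[lam i k * ylo r] and [lam i k * yup r] because [lam i k] is nonnegative and
[y] obeys its bounds, which is where their validity for the common constraints
enters.  Finally, the equations of the full system that correspond to deleted
zero rows of [Amx k] read [0 = lam i k * 0] ([Bmx_row0]). *)

Section Subvectors.
Set Implicit Arguments.
Unset Strict Implicit.
Variables (R : realType) (N : nat) (J : {set 'I_N}).

Lemma subvecE (v : 'cV[R]_N) (s : 'I_#|J|) : subvec J v s 0 = v (enum_val s) 0.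
Proof. by rewrite mxE. Qed.

Lemma enum_val_or_notin (r : 'I_N) :
  (exists s : 'I_#|J|, r = enum_val s) \/ r \notin J.
Proof.
have [rJ|] := boolP (r \in J); [left | by right].
by exists (enum_rank_in rJ r); rewrite enum_rankK_in.
Qed.

Lemma subvecZ (a : R) (v : 'cV[R]_N) : subvec J (a *: v) = a *: subvec J v.
Proof. by apply/matrixP => s q; rewrite !mxE. Qed.

Lemma subvec_sum (K : finType) (F : K -> 'cV[R]_N) :
  subvec J (\sum_k F k) = \sum_k subvec J (F k).
Proof.
apply/matrixP => s q; rewrite mxE !summxE.
by apply: eq_bigr => k _; rewrite mxE.
Qed.

(** In the expansion of [A *m v], the terms with index outside [J] vanish. *)
Lemma mulmx_mxsub_subvec (m : nat) (I : {set 'I_m}) (A : 'M[R]_(m, N))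
    (v : 'cV[R]_N) :
  (forall r, r \notin J -> col r A = 0) ->
  mxsub (fun p : 'I_#|I| => enum_val p) (fun s : 'I_#|J| => enum_val s) A
    *m subvec J v = subvec I (A *m v).
Proof.
move=> A0; apply/matrixP => p q; rewrite !ord1 !mxE.
rewrite [RHS](bigID (mem J)) /= [X in _ + X]big1 ?addr0 => [|r /A0 Ar0].
  by rewrite [RHS]big_enum_val; apply: eq_bigr => s _; rewrite !mxE.
by move/matrixP/(_ (enum_val p) 0): Ar0; rewrite !mxE => ->; rewrite mul0r.
Qed.

(** Entries of [w] take precedence over those of [v].  The [pick] inverts
[enum_val] without needing an element of [J], so that [J] may be empty. *)
Definition extvec (w : 'cV[R]_#|J|) (v : 'cV[R]_N) : 'cV[R]_N :=
  \col_r oapp (fun s => w s 0) (v r 0) [pick s : 'I_#|J| | enum_val s == r].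

Lemma extvec_val w v (s : 'I_#|J|) : extvec w v (enum_val s) 0 = w s 0.
Proof.
rewrite mxE; case: pickP => [t /eqP/enum_val_inj -> // | /(_ s)].
by rewrite eqxx.
Qed.

Lemma extvec_notin w v r : r \notin J -> extvec w v r 0 = v r 0.
Proof.
move=> rJ; rewrite mxE; case: pickP => //= s /eqP es.
by rewrite -es enum_valP in rJ.
Qed.

Lemma subvec_extvec w v : subvec J (extvec w v) = w.
Proof. by apply/matrixP => s q; rewrite ord1 subvecE extvec_val. Qed.

End Subvectors.

Section Hull.
Set Implicit Arguments.
Unset Strict Implicit.
Variables (R : realType) (n : nat) (P : data R n).

Local Notation J := (ctcols P).

(** Only the first entry of [Bmx k] can be nonzero, and the first row of
[Amx k], which encodes [x_i = a_ik], is never deleted. *)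
Lemma Bmx_row0 (i : 'I_n) (k : Dom P i) (r : 'I_(1 + n)) :
  r \notin nzrows k -> Bmx k r 0 = 0.
Proof.
rewrite inE negbK => /eqP; rewrite -[r]splitK; case: (split r) => t /= A0.
  move/matrixP/(_ 0 (rshift (n * n) i)): A0.
  rewrite [LHS]mxE block_mxEur !mxE ord1 !eqxx.
  by move/eqP; rewrite oner_eq0.
by rewrite col_mxEd mxE.
Qed.

Lemma Atmx_subvec (i : 'I_n) (k : Dom P i) (v : 'cV[R]_(n * n + n)) :
  i \in S_I P -> Atmx k *m subvec J v = subvec (nzrows k) (Amx k *m v).
Proof. by move=> iS; apply: mulmx_mxsub_subvec => r; apply: Amx_col0. Qed.

Lemma Atmx_eqP (i : 'I_n) (k : Dom P i) (a : R) (v : 'cV[R]_(n * n + n)) :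
  i \in S_I P ->
  Atmx k *m subvec J v = a *: Btmx k <-> Amx k *m v = a *: Bmx k.
Proof.
move=> iS; rewrite Atmx_subvec // /Btmx -subvecZ; split=> [E|-> //].
apply/matrixP => r q; rewrite ord1.
have [[p ->]|rnz] := enum_val_or_notin (nzrows k) r; first by rewrite -!subvecE E.
rewrite [RHS]mxE Bmx_row0 // mulr0.
move: rnz; rewrite inE negbK => /eqP A0.
have : row r (Amx k *m v) = 0 by rewrite row_mul A0 mul0mx.
by move/matrixP/(_ 0 0); rewrite !mxE.
Qed.

Variables (y : 'cV[R]_(n * n + n)) (lam : forall i, Dom P i -> R).
Arguments lam : clear implicits.

Lemma hull_system_restrict (u : forall i, Dom P i -> 'cV[R]_(n * n + n)) :
  hull_system (@Amx R n P) (@Bmx R n P) (ylo P) (yup P) y lam u ->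
  hull_system (@Atmx R n P) (@Btmx R n P) (subvec J (ylo P)) (subvec J (yup P))
    (subvec J y) lam (fun i k => subvec J (u i k)).
Proof.
move=> H i iS; have [Hy Hb HA Hs Hl] := H i iS; split=> //.
- by rewrite -subvec_sum -Hy.
- by move=> k r; rewrite !subvecE.
- by move=> k; apply/Atmx_eqP.
Qed.

(** Off [ctcols P], exactly one of the vectors receives the whole of [y] and the
others receive [0], so that sums and bounds hold there trivially. *)
Lemma hull_system_extend (w : forall i, Dom P i -> 'cV[R]_#|J|) :
  (forall r, ylo P r 0 <= y r 0 <= yup P r 0) ->
  hull_system (@Atmx R n P) (@Btmx R n P) (subvec J (ylo P)) (subvec J (yup P))
    (subvec J y) lam w ->
  hull_system (@Amx R n P) (@Bmx R n P) (ylo P) (yup P) y lam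
    (fun i k => extvec (w i k) (lam i k *: y)).
Proof.
move=> yb H i iS; have [Hy Hb HA Hs Hl] := H i iS; split=> //.
- apply/matrixP => r q; rewrite ord1 summxE.
  have [[s ->]|rJ] := enum_val_or_notin J r.
    rewrite -subvecE Hy summxE.
    by apply: eq_bigr => k _; rewrite extvec_val.
  under eq_bigr => k _ do rewrite extvec_notin // mxE.
  by rewrite -mulr_suml Hs mul1r.
- move=> k r; have [[s ->]|rJ] := enum_val_or_notin J r.
    by rewrite extvec_val -!subvecE.
  have lam_ge0 : 0 <= lam i k by case: (Hl k) => ->.
  have /andP[ylo_y y_yup] := yb r.
  by rewrite extvec_notin // mxE !ler_wpM2l.
- by move=> k; apply/Atmx_eqP => //; rewrite subvec_extvec.
Qed.

End Hull.

Theorem theorem2 (R : realType) (n : nat) (P : data R n)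
  (Q0_sym : (Q0mat P)^T = Q0mat P)
  (Q_sym : forall i, i \in S_QI P :|: S_QE P -> (Qmat i)^T = Qmat i)
  (x_bounds : forall i, xlo P i 0 <= xup P i 0)
  (aval_inj : forall i, i \in S_I P -> injective (@aval R n P i))
  (y_bounds : forall (x : 'cV[R]_n) (X : 'M[R]_n), common_constraints P x X ->
     forall r, ylo P r 0 <= yvec x X r 0 <= yup P r 0) :
  equivalent_on (P1 := compact_problem P) (P2 := full_problem P)
    (fun p => (px p, pX p)) (fun p => (px p, pX p)).
Proof.
split=> [s|p1 p2 [/= -> ->] //]; split=> -[[x X lam u] /= [C H] <-].
  pose u' i k := extvec (u i k) (lam i k *: yvec x X).
  exists (@Point R n P _ x X lam u') => //=; split=> //.
  by apply: hull_system_extend H; apply: y_bounds.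
pose u' i k := subvec (ctcols P) (u i k).
exists (@Point R n P _ x X lam u') => //=; split=> //.
exact: hull_system_restrict H.
Qed.
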